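(* Let $\mu$ be an admissible even probability measure on $\mathbb{R}$. Then, for any $\delta\in\left(0,\tfrac12\right)$ there exist $c(\mu,\delta)>0$ and $n_0(\mu,\delta)\in\mathbb{N}$ such that $$\varrho_1(\mu_n,\delta)\ge\left(1-\frac{c(\mu,\delta)}{\sqrt n}\right)\mathbb{E}_\mu(\Lambda_\mu^{\ast})$$ for all $n\ge n_0(\mu,\delta)$.
   Context: Let $X$ have distribution $\mu$. Write $x^{\ast}=\sup\{x\in\mathbb{R}:\mu([x,\infty))>0\}$ (possibly $+\infty$), $\Lambda_\mu(t)=\ln\int e^{tx}\,d\mu(x)$, $\Lambda_\mu^{\ast}(x)=\sup_{t\in\mathbb{R}}\{tx-\Lambda_\mu(t)\}$, and $\mathbb{E}_\mu(\Lambda_\mu^\ast)=\int\Lambda_\mu^\ast\,d\mu$. The measure $\mu$ is admissible if: $\mathrm{Var}(X)>0$; there is $r>0$ with $\mathbb{E}e^{tX}<\infty$ for $t\in(-r,r)$; if $x^{\ast}<\infty$ then $\mu(\{x^{\ast}\})=0$; and one of: (1) $x^{\ast}<\infty$, (2) $x^{\ast}=+\infty$ and $\{\Lambda_\mu<\infty\}=\mathbb{R}$, (3) $x^{\ast}=+\infty$, $\{\Lambda_\mu<\infty\}$ bounded and $\mu$ log-concave. Let $\mu_n=\mu^{\otimes n}$. For $N>n$ let $\vec X_1,\dots,\vec X_N$ be i.i.d. random vectors in $\mathbb{R}^n$ with distribution $\mu_n$ (joint law $\mu_n^N$) and $K_N=\mathrm{conv}\{\vec X_1,\dots,\vec X_N\}$.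 For $\delta\in(0,\tfrac12)$, $\varrho_1(\mu_n,\delta)=\sup\{\varrho_1:\sup\{\mathbb{E}_{\mu_n^N}[\mu_n(K_N)]:N\le\exp(\varrho_1 n)\}\le\delta\}$. *)

(* Defs.v *)
From HB Require Import structures.
From mathcomp Require Import all_boot all_order all_algebra.
From mathcomp Require Import all_classical all_reals all_analysis.
Set Implicit Arguments. Unset Strict Implicit. Unset Printing Implicit Defensive.
Import Order.TTheory GRing.Theory Num.Theory.
Import numFieldNormedType.Exports.
Local Open Scope classical_set_scope.
Local Open Scope ring_scope.

Section Defs.
Variable R : realType.

(* Iterated integral over N.-tuples of a "one-coordinate" integration
   operator I : (T -> \bar R) -> \bar R.  For nonnegative measurable f this is
   (by Tonelli) the integral of f against the N-fold product of the measure
   behind I. *)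
Fixpoint iter_int (T : Type) (I : (T -> \bar R) -> \bar R) (N : nat)
  : (N.-tuple T -> \bar R) -> \bar R :=
  match N return (N.-tuple T -> \bar R) -> \bar R with
  | 0 => fun f => f [tuple]
  | N'.+1 => fun f =>
      I (fun x => @iter_int T I N' (fun t : N'.-tuple T => f [tuple of x :: t]))
  end.

Variable mu : probability R R.

Definition int_mu (f : R -> \bar R) : \bar R := (\int[mu]_x f x)%E.

Definition int_mu_n (n : nat) : (n.-tuple R -> \bar R) -> \bar R :=
  @iter_int R int_mu n.

Definition mu_n (n : nat) (A : set (n.-tuple R)) : \bar R :=
  int_mu_n (fun y => (\1_A y)%:E).

Definition E_mu_n_N (n N : nat) (F : N.-tuple (n.-tuple R) -> \bar R) : \bar R :=
  @iter_int (n.-tuple R) (@int_mu_n n) N F.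

Definition conv_hull (n N : nat) (X : N.-tuple (n.-tuple R)) : set (n.-tuple R) :=
  [set y | exists l : 'I_N -> R,
      (forall i, 0 <= l i) /\ \sum_(i < N) l i = 1 /\
      forall j : 'I_n, tnth y j = \sum_(i < N) l i * tnth (tnth X i) j].

Definition E_mu_KN (n N : nat) : \bar R :=
  E_mu_n_N (fun X : N.-tuple (n.-tuple R) => mu_n (conv_hull X)).

Definition rho1 (n : nat) (delta : R) : \bar R :=
  ereal_sup [set r%:E | r in
    [set r : R | (ereal_sup [set E_mu_KN n N | N in
        [set N : nat | (n < N)%N /\ (N%:R <= expR (r * n%:R))%R]] <= delta%:E)%E]].

Definition mgf (t : R) : \bar R := (\int[mu]_x (expR (t * x))%:E)%E.

Definition Lambda (t : R) : \bar R :=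
  match mgf t with
  | r%:E => (ln r)%:E
  | _ => +oo%E
  end.

Definition Lambda_star (x : R) : \bar R :=
  ereal_sup [set ((t * x)%:E - Lambda t)%E | t in [set: R]].

Definition E_Lambda_star : \bar R := (\int[mu]_x Lambda_star x)%E.

Definition xstar : \bar R :=
  ereal_sup [set x%:E | x in [set x : R | (0 < mu [set` `[x, +oo[%R])%E]].

Definition mean : \bar R := (\int[mu]_x x%:E)%E.
Definition variance : \bar R := (\int[mu]_x ((x - fine mean) ^+ 2)%:E)%E.

Definition log_concave : Prop :=
  forall (A B : set R) (l : R), measurable A -> measurable B -> 0 < l < 1 ->
    measurable [set l * a + (1 - l) * b | a in A & b in B] ->
    powR (fine (mu A)) l * powR (fine (mu B)) (1 - l)
      <= fine (mu [set l * a + (1 - l) * b | a in A & b in B]).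

Definition admissible : Prop :=
  (0 < variance)%E /\
  (exists r : R, 0 < r /\ forall t, -r < t < r -> (mgf t < +oo)%E) /\
  ((xstar < +oo)%E -> mu [set fine xstar] = 0%E) /\
  [\/ (xstar < +oo)%E,
      xstar = +oo%E /\ (forall t, (Lambda t < +oo)%E)
    | [/\ xstar = +oo%E,
          (exists M : R, forall t, (Lambda t < +oo)%E -> `|t| <= M)
        & log_concave]].

Definition even_measure : Prop :=
  forall A : set R, measurable A -> mu [set - x | x in A] = mu A.

End Defs.

(* Main.v *)
(** If [y] lies in the hull of [X_1, .., X_N], then for every vector of tilts
    [t] some vertex satisfies [<t, X_k> >= <t, y>]. Choose the coordinate [t_i]
    as a near maximizer of [t * y_i - Lambda t], call the maximum [rate y_i], and
    put [h x y = exp (t(y) * x - Lambda (t(y)))], so that [h] has integral 1 in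
    [x]. Then for all [a] and [lam >= 0] the indicator of the hull at [y] is at most
    [exp (lam * a) * prod_i exp (- lam * rate y_i)
       + exp (- a) * sum_k prod_i h X_ki y_i].
    Both terms are products over the coordinates, hence the expected measure of
    the hull is at most [exp (lam * a) * (E exp (- lam * rate)) ^ n + exp (- a) * N].
    The second moment of [rate] is bounded by an absolute constant, because the
    half-line cut off at [y] on the side of the sign of [t(y)] has measure at most
    [exp (- rate y)]. So [E exp (- lam * rate) <= exp (- lam * E rate + O(lam ^ 2))],
    and [lam = 1 / sqrt n], [a = n * E Lambda_star - O(sqrt n)] give the result. *)

Require Import Defs.
From HB Require Import structures.
From mathcomp Require Import all_boot all_order all_algebra.
From mathcomp Require Import all_classical all_reals all_analysis.
From mathcomp Require Import measurable_realfun.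
From mathcomp Require Import ring lra.
Import Order.TTheory GRing.Theory Num.Theory.
Local Open Scope ring_scope.
Set Implicit Arguments.
Unset Strict Implicit.
Unset Printing Implicit Defensive.

(** * Monotonicity of integrals and of iterated integrals *)

Section MonotoneIntegral.
Context {d} {T : measurableType d} {R : realType}.
Variable mu : {measure set T -> \bar R}.
Local Open Scope ereal_scope.

(* The integral of a nonnegative function is a supremum over the simple
   functions below it, so it is monotone without any measurability. *)
Lemma ge0_le_integral_nonmeas (f g : T -> \bar R) :
  (forall x, 0 <= f x) -> (forall x, f x <= g x) ->
  \int[mu]_x f x <= \int[mu]_x g x.
Proof.
move=> f0 fg; have g0 x : 0 <= g x := le_trans (f0 x) (fg x).
rewrite !ge0_integralTE//; apply: le_ereal_sup => _ [h hf <-].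
by exists h => // x; exact: le_trans (hf x) (fg x).
Qed.

End MonotoneIntegral.

Section IteratedIntegral.
Context {R : realType} {T : Type}.
Variable I : (T -> \bar R) -> \bar R.
Local Open Scope ereal_scope.

Lemma iter_int_ge0 (I0 : forall f, (forall x, 0 <= f x) -> 0 <= I f) N
  (f : N.-tuple T -> \bar R) : (forall t, 0 <= f t) -> 0 <= iter_int I f.
Proof.
by elim: N f => [|N IH] f f0 /=; [exact: f0|apply: I0 => x; exact: IH].
Qed.

(** The operator is abstract because two levels are needed: [int_mu] over the coordinates of a
    vector and [int_mu_n] over the vectors of a sample. *)
Lemma le_iter_int (I0 : forall f, (forall x, 0 <= f x) -> 0 <= I f)
  (Ile : forall f g, (forall x, 0 <= f x) -> (forall x, f x <= g x) -> I f <= I g)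
  N (f g : N.-tuple T -> \bar R) :
  (forall t, 0 <= f t) -> (forall t, f t <= g t) -> iter_int I f <= iter_int I g.
Proof.
elim: N f g => [|N IH] f g f0 fg /=; first exact: fg.
by apply: Ile => x; [exact: iter_int_ge0|exact: IH].
Qed.

End IteratedIntegral.

(** * Iterated integrals of sums of products over the coordinates *)

Section ProductFunctions.
Context {R : realType}.
Variable mu : probability R R.
Local Open Scope ereal_scope.

Lemma int_mu_ge0 (f : R -> \bar R) : (forall x, 0 <= f x) -> 0 <= int_mu mu f.
Proof. by move=> f0; apply: integral_ge0. Qed.

Lemma le_int_mu (f g : R -> \bar R) :
  (forall x, 0 <= f x) -> (forall x, f x <= g x) -> int_mu mu f <= int_mu mu g.
Proof. exact: ge0_le_integral_nonmeas. Qed.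

Lemma int_mu_n_ge0 n (f : n.-tuple R -> \bar R) :
  (forall y, 0 <= f y) -> 0 <= int_mu_n mu f.
Proof. exact/iter_int_ge0/int_mu_ge0. Qed.

Lemma le_int_mu_n n (f g : n.-tuple R -> \bar R) :
  (forall y, 0 <= f y) -> (forall y, f y <= g y) -> int_mu_n mu f <= int_mu_n mu g.
Proof. by apply: le_iter_int; [exact: int_mu_ge0|exact: le_int_mu]. Qed.

Lemma prode_ge0 (J : Type) (r : seq J) (f : J -> \bar R) :
  (forall j, 0 <= f j) -> 0 <= \big[*%E/1]_(j <- r) f j.
Proof. by move=> f0; elim/big_rec: _ => // j x _ x0; rewrite mule_ge0. Qed.

(** Induction on [n]: once the first coordinate is fixed, its factor is absorbed into the weight
    [b j], which is why weights may be infinite. Only one-variable linearity of the integral is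
    used. *)
Lemma int_mu_n_sum_prod (J : Type) (r : seq J) n (b : J -> \bar R)
    (g : J -> 'I_n -> R -> \bar R) :
  (forall j, 0 <= b j) -> (forall j i x, 0 <= g j i x) ->
  (forall j i, measurable_fun setT (g j i)) ->
  int_mu_n mu (fun y => \sum_(j <- r) b j * \big[*%E/1]_(i < n) g j i (tnth y i))
  = \sum_(j <- r) b j * \big[*%E/1]_(i < n) \int[mu]_x g j i x.
Proof.
elim: n b g => [|n IH] b g b0 g0 mg.
  by rewrite /int_mu_n /=; apply: eq_bigr => j _; rewrite !big_ord0.
rewrite /int_mu_n/= -/(int_mu_n mu _) /int_mu.
pose P j := \big[*%E/1]_(i < n) \int[mu]_x g j (lift ord0 i) x.
have P0 j : 0 <= P j by apply: prode_ge0 => i; apply: integral_ge0.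
transitivity (\int[mu]_x (\sum_(j <- r) (b j * P j) * g j ord0 x)).
  apply: eq_integral => x _.
  transitivity (int_mu_n mu (fun t : n.-tuple R => \sum_(j <- r)
      (b j * g j ord0 x) * \big[*%E/1]_(i < n) g j (lift ord0 i) (tnth t i))).
    congr int_mu_n; apply/funext => t; apply: eq_bigr => j _.
    rewrite big_ord_recl muleA tnth0; congr (_ * _); apply: eq_bigr => i _.
    by rewrite tnthS.
  rewrite (IH (fun j => b j * g j ord0 x) (fun j i => g j (lift ord0 i)))//;
    last by move=> j; rewrite mule_ge0.
  by apply: eq_bigr => j _; rewrite muleAC.
rewrite ge0_integral_sum//; last 2 first.
  by move=> j; apply: emeasurable_funM => //; exact: measurable_cst.
  by move=> j x _; rewrite !mule_ge0.
apply: eq_bigr => j _; rewrite ge0_integralZl//; last by rewrite mule_ge0.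
by rewrite big_ord_recl -/(P j) -!muleA (muleC (P j)).
Qed.

Lemma int_mu_n_affine_prod n (c b : \bar R) (g : R -> \bar R) :
  0 <= c -> 0 <= b -> (forall x, 0 <= g x) -> measurable_fun setT g ->
  \int[mu]_x g x = 1 ->
  int_mu_n mu (fun y : n.-tuple R => c + b * \big[*%E/1]_(i < n) g (tnth y i))
  = c + b.
Proof.
move=> c0 b0 g0 mg g1.
(* The constant [c] counts as a product of factors 1, with index [true]. *)
pose B (k : bool) := if k then c else b.
pose G (k : bool) (i : 'I_n) (x : R) := if k then 1 else g x.
transitivity (int_mu_n mu (fun y => \sum_(j <- [:: true; false])
    B j * \big[*%E/1]_(i < n) G j i (tnth y i))).
  congr int_mu_n; apply/funext => y; rewrite !big_cons big_nil /B/G/= adde0.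
  by rewrite [in RHS]big1// mule1.
rewrite (int_mu_n_sum_prod _ (b := B) (g := G)); [|by case|by case|]; last first.
  by case=> i; rewrite /G//; exact: measurable_cst.
rewrite !big_cons big_nil adde0 /B /G/=; congr (_ + _); rewrite big1 ?mule1//.
by move=> i _; rewrite integral_cst// mul1e; exact: probability_setT.
Qed.

Lemma E_mu_n_N_sum_prod n N (c b : R) (g : R -> \bar R) :
  (0 <= c)%R -> (0 <= b)%R -> (forall x, 0 <= g x) -> measurable_fun setT g ->
  \int[mu]_x g x = 1 ->
  E_mu_n_N mu (fun X : N.-tuple (n.-tuple R) =>
    c%:E + \sum_(k < N) b%:E * \big[*%E/1]_(i < n) g (tnth (tnth X k) i))
  = (c + b * N%:R)%:E.
Proof.
move=> c0 b0 g0 mg g1.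
(* The constant is generalized to an extended real so that the term of the first vector, possibly
   infinite, can join it in the induction. *)
suff H C : 0 <= C -> E_mu_n_N mu (fun X : N.-tuple (n.-tuple R) =>
    C + \sum_(k < N) b%:E * \big[*%E/1]_(i < n) g (tnth (tnth X k) i))
    = C + (b * N%:R)%:E by rewrite H ?lee_fin// EFinD.
elim: N C => [|N IH] C C0.
  by rewrite /E_mu_n_N/= big_ord0 mulr0.
rewrite /E_mu_n_N/= -/(E_mu_n_N mu _).
transitivity (int_mu_n mu (fun x : n.-tuple R => (C + (b * N%:R)%:E) +
    b%:E * \big[*%E/1]_(i < n) g (tnth x i))).
  congr int_mu_n; apply/funext => x.
  transitivity (E_mu_n_N mu (fun X : N.-tuple (n.-tuple R) =>
    (C + b%:E * \big[*%E/1]_(i < n) g (tnth x i)) +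
    \sum_(k < N) b%:E * \big[*%E/1]_(i < n) g (tnth (tnth X k) i))).
    congr (E_mu_n_N mu); apply/funext => X; rewrite big_ord_recl tnth0 addeA.
    by congr (_ + _); apply: eq_bigr => k _; rewrite tnthS.
  rewrite IH; first by rewrite addeAC.
  by rewrite adde_ge0// mule_ge0// ?lee_fin// prode_ge0.
rewrite int_mu_n_affine_prod ?lee_fin//.
- by rewrite -addeA -EFinD -natr1 mulrDr mulr1.
- by rewrite adde_ge0// lee_fin mulr_ge0.
Qed.

End ProductFunctions.

(** * The log-Laplace transform and exponential tilting *)

Lemma expR_convex0 {R : realType} (s v : R) : 0 <= s <= 1 ->
  expR (s * v) <= s * expR v + (1 - s).
Proof.
move=> /andP[s0 s1]; have m0 := expR_gt0 (s * v).
(* The tangent of [expR] at [s * v] is compared with [expR] at [v] and at 0; weights [s] and [1 - s]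
   cancel the linear terms. *)
have hv : expR (s * v) * (1 + (v - s * v)) <= expR v.
  rewrite -[in leRHS](subrKC (s * v) v) expRD ler_pM2l//; exact: expR_ge1Dx.
have h0 : expR (s * v) * (1 - s * v) <= 1.
  rewrite -[leRHS](expRxMexpNx_1 (s * v)) ler_pM2l//; exact: expR_ge1Dx.
have := ler_wpM2l s0 hv; have := ler_wpM2l (_ : 0 <= 1 - s) h0.
rewrite subr_ge0 => /(_ s1); nra.
Qed.

Lemma expR_EFin_ge0 {R : realType} (x : R) : (0 <= (expR x)%:E)%E.
Proof. by rewrite lee_fin expR_ge0. Qed.
#[local] Hint Resolve expR_EFin_ge0 : core.

Section LogLaplace.
Context {R : realType}.
Variable mu : probability R R.

Lemma measurable_EFin_expR d (T : measurableType d) (G : T -> R) : measurable_fun setT G ->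
  measurable_fun setT (fun x => (expR (G x))%:E).
Proof.
by move=> mG; apply/measurable_EFinP; apply: measurableT_comp => //; exact: measurable_expR.
Qed.

Lemma measurable_expR_affine (t c : R) :
  measurable_fun setT (fun x => (expR (t * x - c))%:E).
Proof.
apply: measurable_EFin_expR.
by apply: measurable_funB => //; exact: mulrl_measurable.
Qed.

Lemma measurable_expR_linear (t : R) :
  measurable_fun setT (fun x => (expR (t * x))%:E).
Proof. by apply: measurable_EFin_expR; exact: mulrl_measurable. Qed.

Lemma integral_cst_probability (c : R) : (\int[mu]_x c%:E = c%:E)%E.
Proof. by rewrite integral_cst//= probability_setT mule1. Qed.

Lemma mgf_gt0 t : (0 < mgf mu t)%E.
Proof.
rewrite lt0e integral_ge0//.
rewrite andbT; apply/negP => /eqP m0.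
have /ae_eq_integral_abs : (\int[mu]_x `|(expR (t * x))%:E| = 0)%E.
  by rewrite -[RHS]m0; apply: eq_integral => x _; rewrite gee0_abs.
move=> /(_ measurableT (measurable_expR_linear t)) [A [mA A0 sA]].
have : (mu setT = 0)%E.
  apply: (subset_measure0 _ mA _ A0) => // x _; apply: sA => /= /(_ I) /eqP.
  by rewrite eqe gt_eqF// expR_gt0.
by rewrite probability_setT => /eqP; rewrite eqe oner_eq0.
Qed.

(** Real-valued form of [Lambda]; it agrees with [Lambda] only where [mgf] is finite, and is 0
    elsewhere. *)
Definition log_mgf (t : R) : R := ln (fine (mgf mu t)).

Lemma expR_log_mgf t : (mgf mu t < +oo)%E -> (expR (log_mgf t))%:E = mgf mu t.
Proof.
move=> tf; have t0 := mgf_gt0 t.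
by rewrite /log_mgf lnK ?fineK ?posrE ?fine_gt0 ?t0// ge0_fin_numE ?ltW.
Qed.

Lemma Lambda_log_mgf t : (mgf mu t < +oo)%E -> Lambda mu t = (log_mgf t)%:E.
Proof. by rewrite /Lambda /log_mgf; have := mgf_gt0 t; case: (mgf mu t). Qed.

Lemma Lambda_infty t : ~~ (mgf mu t < +oo)%E -> Lambda mu t = +oo%E.
Proof. by rewrite /Lambda; case: (mgf mu t) => // r; rewrite ltry. Qed.

Lemma tilted_integral t : (mgf mu t < +oo)%E ->
  (\int[mu]_x (expR (t * x - log_mgf t))%:E = 1)%E.
Proof.
move=> tf; under eq_integral do rewrite expRD mulrC EFinM.
rewrite ge0_integralZl//; last exact: measurable_expR_linear.
by rewrite -/(mgf mu t) -expR_log_mgf// -EFinM -expRD addrC subrr expR0.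
Qed.

Lemma mgf0 : mgf mu 0 = 1%E.
Proof.
by rewrite /mgf; under eq_integral do rewrite mul0r expR0; exact: integral_cst_probability.
Qed.

Lemma log_mgf0 : log_mgf 0 = 0.
Proof. by rewrite /log_mgf mgf0 ln1. Qed.

(** Convexity on the segment from 0 to [t]. Integrating [expR_convex0] at [v = t * x - log_mgf t],
    where [expR v] has integral 1, gives at most [s + (1 - s) = 1]. *)
Lemma log_mgf_scale s t : 0 <= s <= 1 -> (mgf mu t < +oo)%E ->
  (mgf mu (s * t) < +oo)%E /\ log_mgf (s * t) <= s * log_mgf t.
Proof.
move=> s01 tf; have [s0 s1] := andP s01.
have key : (mgf mu (s * t) <= (expR (s * log_mgf t))%:E)%E.
  rewrite /mgf.
  under eq_integral do rewrite -(subrKC (s * log_mgf t) (s * t * _)) expRD EFinM.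
  rewrite ge0_integralZl//; last exact: measurable_expR_affine.
  rewrite -[leRHS]mule1; apply: lee_pmul => //.
  - by apply: integral_ge0.
  apply: (@le_trans _ _ (\int[mu]_x
      (s%:E * (expR (t * x - log_mgf t))%:E + (1 - s)%:E))%E).
    apply: ge0_le_integral => //.
    - exact: measurable_expR_affine.
    - apply: emeasurable_funD => //; apply: measurable_funeM.
      exact: measurable_expR_affine.
    - by move=> x _; rewrite -EFinM -EFinD lee_fin -mulrA -mulrBr expR_convex0.
  rewrite ge0_integralD//; last 3 first.
  - by move=> x _; rewrite -EFinM lee_fin mulr_ge0// expR_ge0.
  - by apply: measurable_funeM; exact: measurable_expR_affine.
  - by move=> x _; rewrite lee_fin subr_ge0.
  rewrite integral_cst_probability ge0_integralZl//; last first.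
    exact: measurable_expR_affine.
  by rewrite tilted_integral// mule1 -EFinD subrKC.
have stf : (mgf mu (s * t) < +oo)%E by exact: le_lt_trans key (ltry _).
by split => //; move: key; rewrite -expR_log_mgf// lee_fin ler_expR.
Qed.

End LogLaplace.

(** * Measurable near maximizers in the Legendre transform *)

Section RationalSelection.
Context {R : realType}.
Variable mu : probability R R.
Local Notation L := (log_mgf mu).

(** An enumeration of the rational points of the domain of [log_mgf]. Undecodable codes and points
    outside the domain fall back to 0, so every selected tilt has a finite [mgf]. *)
Definition rational_tilt (k : nat) : R :=
  let q := ratr (odflt 0 (unpickle k : option rat)) in
  if (mgf mu q < +oo)%E then q else 0.

(* Only finitely many rational tilts compete, so that the maximizer is a
   measurable function of [y]. *)
Fixpoint best_tilt (m : nat) (y : R) : R :=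
  if m is k.+1 then
    if best_tilt k y * y - L (best_tilt k y)
       < rational_tilt k * y - L (rational_tilt k)
    then rational_tilt k else best_tilt k y
  else 0.

Definition rate (m : nat) (y : R) : R := best_tilt m y * y - L (best_tilt m y).

Lemma rational_tilt_dom k : (mgf mu (rational_tilt k) < +oo)%E.
Proof. by rewrite /rational_tilt; case: ifP => // _; rewrite mgf0 ltry. Qed.

Lemma best_tilt_dom m y : (mgf mu (best_tilt m y) < +oo)%E.
Proof.
elim: m => [|m IH] /=; first by rewrite mgf0 ltry.
by case: ifP => // _; exact: rational_tilt_dom.
Qed.

Lemma rate0 y : rate 0 y = 0.
Proof. by rewrite /rate /= mul0r log_mgf0 subr0. Qed.

Lemma rateS m y : rate m.+1 y =
  Num.max (rate m y) (rational_tilt m * y - L (rational_tilt m)).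
Proof. by rewrite /rate /=; case: ltP. Qed.

Lemma rate_nondecreasing y : {homo rate^~ y : m n / (m <= n)%N >-> m <= n}.
Proof. by apply/nondecreasing_seqP => m; rewrite rateS le_max lexx. Qed.

Lemma rate_ge0 m y : 0 <= rate m y.
Proof. by rewrite -(rate0 y) rate_nondecreasing. Qed.

(** [G] is arbitrary because [best_tilt m] takes finitely many values; this covers [log_mgf mu]
    without any regularity of it. *)
Lemma measurable_best_tilt (G : R -> R) m :
  measurable_fun setT (fun y => G (best_tilt m y)).
Proof.
elim: m G => [|m IH] G /=; first exact: measurable_cst.
under eq_fun do rewrite (fun_if G).
apply: measurable_fun_ifT => //; apply: measurable_fun_ltr.
- by apply: measurable_funB; [apply: measurable_funM; [exact: (IH id)|]|exact: IH].
- by apply: measurable_funB => //; exact: mulrl_measurable.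
Qed.

Lemma measurable_rate m : measurable_fun setT (rate m).
Proof.
apply: measurable_funB; last exact: measurable_best_tilt.
by apply: measurable_funM => //; exact: (measurable_best_tilt id).
Qed.

(* Since [log_mgf (s * t) <= s * log_mgf t] for [s] in [0, 1], rational tilts
   suffice even at the boundary of the domain of [log_mgf]. *)
Lemma Lambda_star_rate y :
  Lambda_star mu y = ereal_sup (range (fun m => (rate m y)%:E)).
Proof.
apply/eqP; rewrite eq_le; apply/andP; split; last first.
  apply: ge_ereal_sup => _ [m _ <-]; apply: ereal_sup_ubound.
  exists (best_tilt m y) => //.
  by rewrite Lambda_log_mgf ?best_tilt_dom// -EFinB.
apply: ge_ereal_sup => _ [t _ <-].
have [tf|tf] := boolP (mgf mu t < +oo)%E; last by rewrite Lambda_infty//= leNye.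
rewrite Lambda_log_mgf// -EFinB; set v := t * y - L t.
have rate_le m : ((rate m y)%:E <= ereal_sup (range (fun m => (rate m y)%:E)))%E.
  by apply: ereal_sup_ubound; exists m.
have [v0|v0] := leP v 0.
  by apply: le_trans (rate_le 0%N); rewrite rate0 lee_fin.
rewrite leNgt; apply/negP => supv.
move: rate_le supv; case: (ereal_sup _) => [r| |] rate_le; last 2 first.
- by [].
- by have := rate_le 0%N; rewrite leeNy_eq.
rewrite lte_fin => rv.
have r0 : 0 <= r by have := rate_le 0%N; rewrite rate0 lee_fin.
have t0 : t != 0.
  by apply: contraTneq v0 => t0; rewrite /v t0 mul0r log_mgf0 subr0 ltxx.
(* If the supremum [r] were below [v], a rational tilt [s * t] with [s > r / v] would reach a value
   of at least [s * v > r]. The sign of [t] only orients the interval that contains the rational. *)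
have [q [s [qE sr s1]]] : exists q s, [/\ ratr q = s * t, r / v < s & s <= 1].
  have rv1 : r / v < 1 by rewrite ltr_pdivrMr// mul1r.
  move: t0; rewrite neq_lt => /orP[tlt0|tgt0].
    have : t < r / v * t by rewrite -[ltLHS]mul1r ltr_nM2r.
    move=> /rat_in_itvoo[q]; rewrite in_itv/= => /andP[q1 q2].
    exists q, (ratr q / t); split; first by rewrite divfK ?lt_eqF.
      by rewrite -(ltr_nM2r tlt0) divfK ?lt_eqF.
    by rewrite -(ler_nM2r tlt0) divfK ?lt_eqF// mul1r ltW.
  have : r / v * t < t by rewrite -[ltRHS]mul1r ltr_pM2r.
  move=> /rat_in_itvoo[q]; rewrite in_itv/= => /andP[q1 q2].
  exists q, (ratr q / t); split; first by rewrite divfK ?gt_eqF.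
    by rewrite -(ltr_pM2r tgt0) divfK ?gt_eqF.
  by rewrite -(ler_pM2r tgt0) divfK ?gt_eqF// mul1r ltW.
have s0 : 0 <= s by apply: le_trans (ltW sr); rewrite divr_ge0// ltW.
have [stf Lst] := @log_mgf_scale _ mu s t (introT andP (conj s0 s1)) tf.
(* The tilt of index [pickle q] enters the competition at the next stage. *)
have := rate_le (pickle q).+1; rewrite lee_fin rateS ge_max => /andP[_].
rewrite /rational_tilt pickleK /= qE stf; apply/negP; rewrite -ltNge.
apply: (@lt_le_trans _ _ (s * v)); first by rewrite -ltr_pdivrMr.
by rewrite /v mulrBr mulrA lerB.
Qed.

Lemma rate_cvg y : ((rate m y)%:E @[m --> \oo] --> Lambda_star mu y)%classic.
Proof.
rewrite Lambda_star_rate; apply: ereal_nondecreasing_cvgn => m n mn.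
by rewrite lee_fin rate_nondecreasing.
Qed.

Lemma measurable_EFin_rate m : measurable_fun setT (fun y => (rate m y)%:E).
Proof. by apply/measurable_EFinP; exact: measurable_rate. Qed.

(** Monotone convergence; later estimates can then be made at a fixed stage [m], uniformly in
    [m]. *)
Lemma E_Lambda_star_rate :
  E_Lambda_star mu = ereal_sup (range (fun m => \int[mu]_y (rate m y)%:E)%E).
Proof.
pose g (m : nat) (y : R) := (rate m y)%:E.
have nd y : {homo g^~ y : n m / (n <= m)%N >-> (n <= m)%E}.
  by move=> n m nm; rewrite lee_fin rate_nondecreasing.
have g0 m y : (0 <= g m y)%E by rewrite lee_fin rate_ge0.
have := @cvg_monotone_convergence _ _ _ mu _ measurableT g
  (fun m => measurable_EFin_rate m) (fun m y _ => g0 m y) (fun y _ => nd y).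
rewrite (eq_integral (Lambda_star mu)); last first.
  by move=> y _; apply/cvg_lim => //; exact: rate_cvg.
move=> /cvg_lim E; rewrite /E_Lambda_star -E//; apply/cvg_lim => //.
apply: ereal_nondecreasing_cvgn => m n mn.
by apply: ge0_le_integral_nonmeas => y; [exact: g0|exact: nd].
Qed.

End RationalSelection.

(** * Exponential bound on the expected measure of the hull *)

Section HullBound.
Context {R : realType}.
Variable mu : probability R R.
Local Notation L := (log_mgf mu).

Definition tilt_density (m : nat) (x y : R) : R :=
  expR (best_tilt mu m y * x - L (best_tilt mu m y)).

Lemma tilt_density_ge0 m x y : (0 <= (tilt_density m x y)%:E)%E.
Proof. by rewrite lee_fin expR_ge0. Qed.

Lemma measurable_tilt_density m :
  measurable_fun setT (fun z : R * R => (tilt_density m z.1 z.2)%:E).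
Proof.
apply: measurable_EFin_expR; apply: measurable_funB.
  apply: measurable_funM => //.
  apply: (measurableT_comp (measurable_best_tilt mu id m)); exact: measurable_snd.
by apply: (measurableT_comp (measurable_best_tilt mu L m)); exact: measurable_snd.
Qed.

Lemma prod_EFin (n : nat) (f : 'I_n -> R) :
  (\big[*%E/1]_(i < n) (f i)%:E)%E = (\prod_(i < n) f i)%:E.
Proof. by elim/big_ind2 : _ => // x a y b -> ->. Qed.

Lemma lee_prode n (f g : 'I_n -> \bar R) :
  (forall i, 0 <= f i)%E -> (forall i, f i <= g i)%E ->
  (\big[*%E/1]_(i < n) f i <= \big[*%E/1]_(i < n) g i)%E.
Proof.
move=> f0 fg.
suff /andP[] : (0 <= \big[*%E/1]_(i < n) f i <= \big[*%E/1]_(i < n) g i)%E by [].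
elim/big_ind2 : _ => [|x1 x2 y1 y2 /andP[? ?] /andP[? ?]|i _].
- by rewrite lee01 lexx.
- by rewrite mule_ge0//= lee_pmul.
- by rewrite f0 fg.
Qed.

(** If every vertex had a value strictly below that of [y], the convex weights times the positive
    gaps would sum to 0, so all weights would vanish. *)
Lemma conv_hull_functional n N (X : N.-tuple (n.-tuple R)) (y : n.-tuple R)
    (t : 'I_n -> R) : conv_hull X y ->
  exists k, \sum_(i < n) t i * tnth y i <= \sum_(i < n) t i * tnth (tnth X k) i.
Proof.
move=> [l [l0 [l1 ly]]]; apply/not_existsP => H.
pose A k := \sum_(i < n) t i * tnth (tnth X k) i.
pose B := \sum_(i < n) t i * tnth y i.
have AB k : A k < B by rewrite ltNge; apply/negP; exact: H.
have E : \sum_(k < N) l k * (B - A k) = 0.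
  under eq_bigr do rewrite mulrBr.
  rewrite sumrB -mulr_suml l1 mul1r; apply/eqP; rewrite subr_eq0; apply/eqP.
  rewrite /B; under eq_bigr do rewrite ly mulr_sumr.
  rewrite exchange_big/=; apply: eq_bigr => k _; rewrite mulr_sumr.
  by apply: eq_bigr => i _; rewrite mulrCA.
have l_eq0 k : l k = 0.
  have /eqP := E; rewrite psumr_eq0; last first.
    by move=> j _; rewrite mulr_ge0// subr_ge0 ltW.
  move=> /allP /(_ k (mem_index_enum _)) /=; rewrite mulf_eq0 subr_eq0.
  by rewrite (gt_eqF (AB k)) orbF => /eqP.
by move: l1; rewrite big1// => /esym/eqP; rewrite oner_eq0.
Qed.

(* Either [sum rate (y_i) < a], where the first summand is at least 1, or some
   vertex lies in the half-space given by the tilts at [y], where the second is. *)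
Lemma conv_hull_indic_le m n N (X : N.-tuple (n.-tuple R)) (y : n.-tuple R)
    (a lam : R) : 0 <= lam ->
  \1_(conv_hull X) y <=
    expR (lam * a) * \prod_(i < n) expR (- (lam * rate mu m (tnth y i)))
    + \sum_(k < N) expR (- a) * \prod_(i < n) tilt_density m (tnth (tnth X k) i) (tnth y i).
Proof.
move=> lam0; rewrite indicE.
have P0 : 0 <= expR (lam * a) * \prod_(i < n) expR (- (lam * rate mu m (tnth y i))).
  by rewrite mulr_ge0 ?expR_ge0// prodr_ge0// => i _; rewrite expR_ge0.
have Q0 k : 0 <= expR (- a) * \prod_(i < n) tilt_density m (tnth (tnth X k) i) (tnth y i).
  by rewrite mulr_ge0 ?expR_ge0// prodr_ge0// => i _; rewrite expR_ge0.
have [|] := boolP (y \in conv_hull X); last by rewrite addr_ge0// sumr_ge0.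
rewrite inE => yX; have [sa|sa] := ltP (\sum_(i < n) rate mu m (tnth y i)) a.
  rewrite -[leLHS]addr0 lerD ?sumr_ge0// -expR_sum -expRD -[leLHS]expR0 ler_expR.
  by rewrite sumrN -mulr_sumr -mulrBr mulr_ge0// subr_ge0 ltW.
have [k hk] := conv_hull_functional (fun i => best_tilt mu m (tnth y i)) yX.
rewrite -[leLHS]add0r lerD// (bigD1 k)//= -[leLHS]addr0 lerD ?sumr_ge0//.
rewrite -expR_sum -expRD -[leLHS]expR0 ler_expR addrC subr_ge0.
by apply: (le_trans sa); rewrite !sumrB lerD2r.
Qed.

Lemma integral_tilt_density m y : (\int[mu]_x (tilt_density m x y)%:E = 1)%E.
Proof. exact/tilted_integral/best_tilt_dom. Qed.

Lemma E_mu_KN_le m n N (a lam M : R) : 0 <= lam ->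
  (\int[mu]_y (expR (- (lam * rate mu m y)))%:E <= M%:E)%E ->
  (E_mu_KN mu n N <= (expR (lam * a) * M ^+ n + expR (- a) * N%:R)%:E)%E.
Proof.
move=> lam0 hM.
pose u y := (expR (- (lam * rate mu m y)))%:E.
have u0 y : (0 <= u y)%E by rewrite expR_EFin_ge0.
have mu_ : measurable_fun setT u.
  apply: measurable_EFin_expR; apply: measurable_funN.
  by apply: measurable_funM => //; exact: measurable_rate.
have M0 : 0 <= M by rewrite -lee_fin; apply: le_trans hM; exact: integral_ge0.
pose f (z : R * R) := (tilt_density m z.1 z.2)%:E.
have f0 z : (0 <= f z)%E by exact: tilt_density_ge0.
(* For a fixed sample [y] is integrated first, which turns each density factor into [g] at a vertex
   coordinate. By Tonelli [g] has integral 1, since the density does in [x] for each [y]. *)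
pose g := fubini_F mu f.
have g0 x : (0 <= g x)%E by apply: integral_ge0 => y _; exact: f0.
have mg : measurable_fun setT g.
  by apply: measurable_fun_fubini_tonelli_F => //; exact: measurable_tilt_density.
have g1 : (\int[mu]_x g x = 1)%E.
  rewrite /g /fubini_F fubini_tonelli//; last exact: measurable_tilt_density.
  under eq_integral do rewrite integral_tilt_density.
  exact: integral_cst_probability.
rewrite -(@E_mu_n_N_sum_prod _ mu n N (expR (lam * a) * M ^+ n) (expR (- a)) g)//;
  last by rewrite mulr_ge0 ?expR_ge0 ?exprn_ge0.
apply: le_iter_int => [h h0|h1 h2 h0 h12|X|X].
- exact: int_mu_n_ge0.
- exact: le_int_mu_n.
- by apply: int_mu_n_ge0 => y; rewrite lee_fin.
(* [None] indexes the rate term and [Some k] the term of vertex [k], so that a single sum of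
   products covers both. *)
pose b (k : option 'I_N) : \bar R :=
  if k is Some _ then (expR (- a))%:E else (expR (lam * a))%:E.
pose G (k : option 'I_N) (i : 'I_n) (y : R) : \bar R :=
  if k is Some k then f (tnth (tnth X k) i, y) else u y.
pose r := None :: [seq Some k | k <- index_enum 'I_N].
apply: (@le_trans _ _ (int_mu_n mu (fun y => \sum_(k <- r)
    b k * \big[*%E/1]_(i < n) G k i (tnth y i))%E)).
  apply: le_int_mu_n => y; first by rewrite lee_fin.
  rewrite big_cons big_map /b /G /u /f/= prod_EFin -EFinM.
  under eq_bigr do rewrite prod_EFin -EFinM.
  by rewrite sumEFin -EFinD lee_fin conv_hull_indic_le.
rewrite int_mu_n_sum_prod.
- rewrite big_cons big_map; apply: leeD.
    rewrite /b EFinM; apply: lee_pmul => //.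
      by apply: prode_ge0 => i; apply: integral_ge0 => x _; exact: u0.
    have -> : (M ^+ n)%:E = (\big[*%E/1]_(i < n) M%:E)%E.
      by rewrite prod_EFin prodr_const card_ord.
    by apply: lee_prode => i; [apply: integral_ge0 => x _; exact: u0|exact: hM].
  by apply: lee_sum.
- by case=> [k|]; exact: expR_EFin_ge0.
- by case=> [k|] i x; [exact: f0|exact: u0].
- case=> [k|] i; rewrite /G//.
  exact: (measurableT_comp (measurable_tilt_density m)).
Qed.
End HullBound.

(** * Tails and second moment of the rate *)

Section SecondMoment.
Context {R : realType}.
Variable mu : probability R R.

Lemma measurable_half_line (r : rel R) y :
  measurable [set z : R * R | r z.1 z.2]%classic -> measurable [set x | r y x]%classic.
Proof.
move=> mD; set D := [set z | _]%classic in mD.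
have -> : [set x | r y x]%classic = (pair y @^-1` D)%classic by [].
by rewrite -[X in measurable X]setTI; exact: measurable_pair1.
Qed.

(* [P(X, Y \in A)] for [X, Y] independent is at most
   [P(Y \in A, r Y X) + P(X \in A, r X Y)] because [r] is total. *)
Lemma probability_le_tails (r : rel R) (A : set R) (u : R) : 0 <= u ->
  total r -> measurable [set z : R * R | r z.1 z.2]%classic -> measurable A ->
  (forall y, A y -> (mu [set x | r y x]%classic <= u%:E)%E) ->
  (mu A <= (2 * u)%:E)%E.
Proof.
move=> u0 tr mD mA Au; set D := [set z | _]%classic in mD.
pose F (z : R * R) : \bar R := (\1_A z.1 * \1_D z)%:E.
have F0 z : (0 <= F z)%E by rewrite lee_fin mulr_ge0.
have mF : measurable_fun setT F.
  apply/measurable_EFinP; apply: measurable_funM.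
    by apply: (measurableT_comp (measurable_indic mA)); exact: measurable_fst.
  exact: measurable_indic.
have mFl x : measurable_fun setT (fun y => F (x, y)) by exact: measurableT_comp.
have mFr x : measurable_fun setT (fun y => F (y, x)) by exact: measurableT_comp.
have mIA : measurable_fun setT (fun x => (\1_A x)%:E : \bar R).
  by apply/measurable_EFinP; exact: measurable_indic.
have IA : (\int[mu]_x (\1_A x)%:E = mu A)%E by rewrite integral_indic// setIT.
have mDy y := measurable_half_line y mD.
have [A0|A0] := eqVneq (mu A) 0%E; first by rewrite A0 lee_fin mulr_ge0.
have K : (\int[mu]_x \int[mu]_y F (x, y) <= u%:E * mu A)%E.
  rewrite -IA -ge0_integralZl//.
  apply: ge0_le_integral_nonmeas => x; first exact: integral_ge0.
  rewrite /F /= indicE; have [xA|xA] := boolP (x \in A).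
    rewrite mule1; under eq_integral do rewrite mul1r.
    have -> : (\int[mu]_y (\1_D (x, y))%:E = \int[mu]_y (\1_[set y | r x y] y)%:E)%E.
      by apply: eq_integral => y _; rewrite !indicE; congr (_%:R%:E).
    by rewrite integral_indic// setIT; apply: Au; rewrite inE in xA.
  under eq_integral do rewrite mul0r.
  by rewrite integral0 mule0.
(* The square is the probability that two independent points lie in [A]; one factor [mu A], now
   nonzero, is cancelled at the end. *)
have : (mu A * mu A <= u%:E * mu A + u%:E * mu A)%E.
  rewrite -[in leLHS]IA -ge0_integralZr//; last exact: integral_ge0.
  apply: (@le_trans _ _ (\int[mu]_x (\int[mu]_y F (x, y) + \int[mu]_y F (y, x)))%E).
    apply: ge0_le_integral_nonmeas => x;
      first by rewrite IA; apply: mule_ge0; rewrite ?lee_fin ?measure_ge0.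
    rewrite -ge0_integralD// -ge0_integralZl//.
    apply: ge0_le_integral_nonmeas => y; first by rewrite -EFinM lee_fin mulr_ge0.
    rewrite -EFinM -EFinD lee_fin /= !indicE.
    have [xA|] := boolP (x \in A); last by rewrite !mul0r add0r mulr_ge0.
    have [yA|] := boolP (y \in A); last by rewrite mulr0 mul0r addr0 mulr_ge0.
    rewrite !mul1r; have [|] := boolP ((x, y) \in D); first by rewrite lerDl.
    have [|] := boolP ((y, x) \in D); first by rewrite add0r.
    by rewrite !notin_setE /D/= => yx xy; have /orP[] := tr x y.
  rewrite ge0_integralD//; last 4 first.
  - by move=> x _; exact: integral_ge0.
  - exact: (measurable_fun_fubini_tonelli_F F).
  - by move=> x _; exact: integral_ge0.
  - exact: (measurable_fun_fubini_tonelli_G F).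
  by apply: leeD; [exact: K|rewrite -(fubini_tonelli F)].
have [p pE] : exists p, mu A = p%:E.
  by exists (fine (mu A)); rewrite fineK// fin_num_measure.
have p0 : 0 < p by rewrite -lte_fin -pE lt0e A0 measure_ge0.
rewrite pE -!EFinM -EFinD !lee_fin -mulrDl => h.
by move: h; rewrite ler_pM2r// mulr_natl mulr2n.
Qed.

(** Chernoff bound: [expR (- rate m y) * tilt_density m x y = expR (t * (x - y))] for the tilt [t]
    at [y], which is at least 1 on the half-line, and the density has integral 1. *)
Lemma half_line_le m (r : rel R) y : measurable [set x | r y x]%classic ->
  (forall x, r y x -> 0 <= best_tilt mu m y * (x - y)) ->
  (mu [set x | r y x]%classic <= (expR (- rate mu m y))%:E)%E.
Proof.
move=> mr hr; set H := [set x | r y x]%classic in mr *.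
rewrite -[mu H](_ : \int[mu]_x (\1_H x)%:E = _)%E; last first.
  by rewrite integral_indic// setIT.
rewrite -[leRHS]mule1 -(integral_tilt_density mu m y) -ge0_integralZl//; last 2 first.
- exact: measurable_expR_affine.
- by move=> x _; exact: tilt_density_ge0.
apply: ge0_le_integral_nonmeas => x; first by rewrite lee_fin.
rewrite -EFinM lee_fin -expRD indicE.
have [|_] := boolP (x \in _); last by rewrite expR_ge0.
rewrite inE/= => yx; rewrite -[leLHS]expR0 ler_expR /rate.
by move: (hr x yx); rewrite mulrBr; lra.
Qed.

Lemma measurable_rate_ge m (s : R) : measurable [set y | s <= rate mu m y]%classic.
Proof.
rewrite -[X in measurable X]setTI.
have : measurable_fun setT (fun y => s <= rate mu m y).
  by apply: measurable_fun_ler => //; exact: measurable_rate.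
by move=> /(_ measurableT [set true]%classic) /(_ I).
Qed.

Lemma measurable_best_tilt_ge0 m : measurable [set y | 0 <= best_tilt mu m y]%classic.
Proof.
rewrite -[X in measurable X]setTI.
have : measurable_fun setT (fun y => 0 <= best_tilt mu m y).
  by apply: measurable_fun_ler => //; exact: (measurable_best_tilt mu id).
by move=> /(_ measurableT [set true]%classic) /(_ I).
Qed.

Lemma rate_half_tail_le m (r : rel R) (Q : set R) (s : R) : total r ->
  measurable [set z : R * R | r z.1 z.2]%classic -> measurable Q ->
  (forall y x, Q y -> r y x -> 0 <= best_tilt mu m y * (x - y)) ->
  (mu (Q `&` [set y | (s <= rate mu m y)%R])%classic <= (2 * expR (- s))%:E)%E.
Proof.
move=> tr mD mQ hQ; apply: (probability_le_tails _ tr mD); first exact: expR_ge0.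
  by apply: measurableI => //; exact: measurable_rate_ge.
move=> y [Qy sy]; apply: (le_trans (half_line_le _ _)).
- exact: measurable_half_line.
- by move=> x; exact: hQ.
- by rewrite lee_fin ler_expR lerN2.
Qed.

(** Points are split by the sign of their tilt: nonnegative tilts go with right half-lines, negative
    ones with left half-lines. Each class contributes a factor 2. *)
Lemma rate_tail_le m (s : R) :
  (mu [set y | (s <= rate mu m y)%R]%classic <= (4 * expR (- s))%:E)%E.
Proof.
pose Q := [set y | 0 <= best_tilt mu m y]%classic.
have mQ : measurable Q := measurable_best_tilt_ge0 m.
have mS := measurable_rate_ge m s.
rewrite -[X in mu X]setTI -(setUv Q) setIUl.
apply: le_trans (measureU2 _ _ _) _; [exact: measurableI| |].
  by apply: measurableI => //; exact: measurableC.
have -> : 4 * expR (- s) = 2 * expR (- s) + 2 * expR (- s) :> R by ring.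
have mle : measurable_fun setT (fun z : R * R => z.1 <= z.2).
  by apply: measurable_fun_ler; [exact: measurable_fst|exact: measurable_snd].
have mge : measurable_fun setT (fun z : R * R => z.2 <= z.1).
  by apply: measurable_fun_ler; [exact: measurable_snd|exact: measurable_fst].
rewrite EFinD; apply: leeD.
  apply: (@rate_half_tail_le m (fun a b => a <= b)) => //.
  - by move: (mle measurableT [set true]%classic I); rewrite setTI.
  - by move=> y x Qy yx; rewrite mulr_ge0// subr_ge0.
apply: (@rate_half_tail_le m (fun a b => b <= a)) => //.
- by move: (mge measurableT [set true]%classic I); rewrite setTI.
- exact: measurableC.
- move=> y x /= /negP; rewrite -ltNge => ty yx.
  by rewrite -mulrNN mulr_ge0// oppr_ge0 ?subr_le0// ltW.
Qed.

(** From [k + 1 <= expR k] and [2 ^ k <= expR k] follows [(k + 1) ^ 2 * 2 ^ k <= expR (4 * k)]; the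
    constant is [16 * 4 * 2 = 128]. *)
Lemma geometric_weight_le k :
  (4 * k.+1%:R) ^+ 2 * (4 * expR (- (4 * k%:R))) <= 128 / (2 ^ (k + 1))%:R :> R.
Proof.
have e1 : k.+1%:R <= expR k%:R :> R by rewrite -natr1 addrC expR_ge1Dx.
have e2 : 2 ^+ k <= expR k%:R :> R.
  by rewrite -[k%:R]mulr1 expRM_natl lerXn2r ?nnegrE ?expR_ge0//;
    have := @expR_ge1Dx R 1; lra.
rewrite natrX addn1 (exprS _ k).
have p2 : 0 < 2 ^+ k :> R by rewrite exprn_gt0.
have E0 := expR_gt0 (k%:R : R).
have -> : expR (- (4 * k%:R)) = (expR k%:R ^+ 4)^-1 :> R by rewrite expRN expRM_natl.
set E := expR k%:R in e1 e2 E0 *; set p := 2 ^+ k in e2 p2 *.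
rewrite mulrA ler_pdivrMr ?exprn_gt0// [leRHS]mulrAC ler_pdivlMr ?mulr_gt0//.
have E1 : 1 <= E by rewrite -expR0 ler_expR.
have h1 : k.+1%:R ^+ 2 <= E ^+ 2 by apply: lerXn2r; rewrite ?nnegrE // ltW.
have h2 : p <= E ^+ 2 by rewrite expr2 (le_trans e2)// ler_peMr// ltW.
have h3 : k.+1%:R ^+ 2 * p <= E ^+ 2 * E ^+ 2.
  by apply: ler_pM => //; exact: ltW.
have -> : E ^+ 4 = E ^+ 2 * E ^+ 2 by rewrite -exprD.
by move: h3; generalize (k.+1%:R : R) => a h3; lra.
Qed.

(* [rate ^+ 2 <= sum_k (4 * k.+1) ^+ 2 * \1_(rate >= 4 * k)], and the weighted
   tails are dominated by a geometric series. *)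
Lemma integral_rate_sqr_le m : (\int[mu]_y ((rate mu m y) ^+ 2)%:E <= 128%:E)%E.
Proof.
pose A k := [set y | 4 * k%:R <= rate mu m y]%classic.
have mA k : measurable (A k) := measurable_rate_ge m _.
pose w k : R := (4 * k.+1%:R) ^+ 2.
have w0 k : 0 <= w k by rewrite exprn_ge0// mulr_ge0.
pose f k y : \bar R := ((w k)%:E * (\1_(A k) y)%:E)%E.
have f0 k y : (0 <= f k y)%E by rewrite /f -EFinM lee_fin mulr_ge0.
have mIA k : measurable_fun setT (fun y => (\1_(A k) y)%:E : \bar R).
  by apply/measurable_EFinP; exact: measurable_indic.
have mf k : measurable_fun setT (f k) by exact: measurable_funeM.
apply: (@le_trans _ _ (\int[mu]_y (\sum_(0 <= k <oo) f k y))%E).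
  apply: ge0_le_integral_nonmeas => y; first by rewrite lee_fin exprn_ge0// rate_ge0.
  (* With [k] the integer part of [rate / 4], the [k]-th term alone dominates, as
     [4 * k <= rate < 4 * (k + 1)]. *)
  have /andP[k1 k2] := truncn_itv (divr_ge0 (rate_ge0 mu m y) (ler0n R 4)).
  set k := Num.trunc _ in k1 k2.
  apply: le_trans (@nneseries_lim_ge _ (f^~ y) xpredT 0 k.+1 (fun k _ _ => f0 k y)).
  rewrite big_nat_recr//= -[leLHS]add0e; apply: leeD; first exact: sume_ge0.
  rewrite /f indicE mem_set ?mule1/= ?lee_fin; last first.
    by rewrite /A/= mulrC -ler_pdivlMr.
  rewrite /w ler_pXn2r ?nnegrE ?rate_ge0 ?mulr_ge0//.
  by rewrite mulrC -ler_pdivrMr// ltW.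
rewrite integral_nneseries//.
apply: (@le_trans _ _ (\sum_(0 <= k <oo) (128 / (2 ^ (k + 1))%:R)%:E)%E).
  apply: lee_nneseries => [k _ _|k _]; first exact: integral_ge0.
  rewrite /f ge0_integralZl//; last by rewrite lee_fin w0.
  rewrite integral_indic// setIT.
  apply: le_trans (lee_wpmul2l _ (rate_tail_le m _)) _; first by rewrite lee_fin.
  by rewrite -EFinM lee_fin geometric_weight_le.
have /cvg_lim -> // := @cvg_geometric_eseries_half R 128 0.
by rewrite expr0 divr1.
Qed.

End SecondMoment.

(* [expR (- u) <= 1 / (1 + u) <= 1 - u + u ^+ 2] *)
Lemma expRN_quadratic {R : realType} (u : R) : 0 <= u -> expR (- u) + u <= 1 + u ^+ 2.
Proof.
move=> u0; have u1 : 0 < 1 + u by rewrite ltr_wpDr.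
have h : expR (- u) * (1 + u) <= 1.
  rewrite -[leRHS](expRxMexpNx_1 u) mulrC ler_wpM2r ?expR_ge0//.
  exact: expR_ge1Dx.
have : expR (- u) * (1 + u) <= (1 - u + u ^+ 2) * (1 + u).
  apply: (le_trans h); have : 0 <= u ^+ 3 by rewrite exprn_ge0.
  by rewrite (_ : _ * _ = 1 + u ^+ 3); [lra|ring].
by rewrite ler_pM2r//; lra.
Qed.

(** * Laplace transform of the rate and the lower threshold *)

Section LowerThreshold.
Context {R : realType}.
Variable mu : probability R R.

Lemma laplace_rate_le m (lam e : R) : 0 <= lam ->
  (e%:E <= \int[mu]_y (rate mu m y)%:E)%E ->
  (\int[mu]_y (expR (- (lam * rate mu m y)))%:E
     <= (expR (- (lam * e) + 128 * lam ^+ 2))%:E)%E.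
Proof.
move=> lam0 he.
have r0 y : (0 <= (rate mu m y)%:E)%E by rewrite lee_fin rate_ge0.
have mr := measurable_EFin_rate mu m.
have mu_ : measurable_fun setT (fun y => (expR (- (lam * rate mu m y)))%:E).
  apply: measurable_EFin_expR; apply: measurable_funN.
  by apply: measurable_funM => //; exact: measurable_rate.
have mr2 : measurable_fun setT (fun y => ((rate mu m y) ^+ 2)%:E).
  by apply/measurable_EFinP; apply: measurable_funX; exact: measurable_rate.
(* [expRN_quadratic] is integrated with the linear term on the left, which keeps all integrands
   nonnegative; [1 + z <= expR z] concludes. *)
have h : (\int[mu]_y (expR (- (lam * rate mu m y)))%:E + (lam * e)%:E
    <= (1 + 128 * lam ^+ 2)%:E)%E.
  apply: (@le_trans _ _ (\int[mu]_y ((expR (- (lam * rate mu m y)))%:E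
      + lam%:E * (rate mu m y)%:E))%E).
    rewrite ge0_integralD//; last 2 first.
    - by move=> y _; rewrite mule_ge0.
    - exact: measurable_funeM.
    by apply: leeD => //; rewrite ge0_integralZl// EFinM lee_wpmul2l.
  apply: (@le_trans _ _ (\int[mu]_y (1%:E
      + (lam ^+ 2)%:E * ((rate mu m y) ^+ 2)%:E))%E).
    apply: ge0_le_integral_nonmeas => y; first by rewrite adde_ge0 ?mule_ge0.
    by rewrite -!EFinM -!EFinD lee_fin -exprMn expRN_quadratic// mulr_ge0// rate_ge0.
  rewrite ge0_integralD//; last 2 first.
  - by move=> y _; rewrite -EFinM lee_fin mulr_ge0 ?exprn_ge0// rate_ge0.
  - exact: measurable_funeM.
  rewrite integral_cst_probability EFinD; apply: leeD => //.
  rewrite ge0_integralZl//; last 2 first.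
  - by move=> y _; rewrite lee_fin exprn_ge0// rate_ge0.
  - by rewrite lee_fin exprn_ge0.
  rewrite [128 * _]mulrC (EFinM _ 128) lee_wpmul2l ?lee_fin ?exprn_ge0//.
  exact: integral_rate_sqr_le.
apply: (@le_trans _ _ (1 + (- (lam * e) + 128 * lam ^+ 2))%:E).
  rewrite (_ : 1 + _ = (1 + 128 * lam ^+ 2) - lam * e); last by ring.
  by rewrite EFinB leeBrDr.
by rewrite lee_fin expR_ge1Dx.
Qed.

Lemma E_Lambda_star_ge0 : (0 <= E_Lambda_star mu)%E.
Proof.
rewrite E_Lambda_star_rate; apply: (@le_trans _ _ (\int[mu]_y (rate mu 0 y)%:E)%E).
  by apply: integral_ge0 => y _; rewrite lee_fin rate_ge0.
by apply: ereal_sup_ubound; exists 0%N.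
Qed.

(** Follows from [r <= 1 + r ^ 2] and the second moment bound, which is uniform in [m]. *)
Lemma E_Lambda_star_fin_num : E_Lambda_star mu \is a fin_num.
Proof.
rewrite ge0_fin_numE ?E_Lambda_star_ge0// E_Lambda_star_rate.
apply: (@le_lt_trans _ _ (1 + 128)%:E); last exact: ltry.
apply: ge_ereal_sup => _ [m _ <-].
apply: (@le_trans _ _ (\int[mu]_y (1%:E + ((rate mu m y) ^+ 2)%:E))%E).
  apply: ge0_le_integral_nonmeas => y; first by rewrite lee_fin rate_ge0.
  by rewrite -EFinD lee_fin; have := sqr_ge0 (rate mu m y - 1); nra.
rewrite ge0_integralD//; last 2 first.
- by move=> y _; rewrite lee_fin exprn_ge0// rate_ge0.
- by apply/measurable_EFinP; apply: measurable_funX; exact: measurable_rate.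
by rewrite integral_cst_probability EFinD leeD// integral_rate_sqr_le.
Qed.

(* [129 = 128 + 1]: the second moment bound, and the loss of [1 / sqrt n] in
   replacing [Lambda_star] by some [rate m]. *)
Lemma E_mu_KN_le_threshold n N (q e : R) : (0 < n)%N -> 0 <= q ->
  E_Lambda_star mu = e%:E ->
  N%:R <= expR ((e - (129 + 2 * q) / Num.sqrt n%:R) * n%:R) ->
  (E_mu_KN mu n N <= (2 * expR (- q))%:E)%E.
Proof.
move=> n0 q0 Ee hN; pose s : R := (Num.sqrt n%:R)^-1.
have n0R : 0 < n%:R :> R by rewrite ltr0n.
have s0 : 0 < s by rewrite invr_gt0 sqrtr_gt0.
have ns2 : n%:R * s ^+ 2 = 1 by rewrite exprVn sqr_sqrtr ?mulfV ?gt_eqF// ltW.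
have ns1 : 1 <= n%:R * s.
  rewrite -[leLHS]ns2 expr2 mulrA ler_piMr ?mulr_ge0 ?(ltW s0)//.
  by rewrite /s invf_le1 ?sqrtr_gt0// -[leLHS]sqrtr1 ler_wsqrtr// ler1n.
have [m hm] : exists m, ((e - s)%:E <= \int[mu]_y (rate mu m y)%:E)%E.
  have := @ub_ereal_sup_adherent _ (range (fun m => \int[mu]_y (rate mu m y)%:E)%E) s s0.
  rewrite -E_Lambda_star_rate => /(_ E_Lambda_star_fin_num)[_ [m _ <-]].
  by rewrite Ee -EFinB => /ltW ?; exists m.
(* This [a] makes the first summand at most [expR (- q)], as [n * s ^ 2 = 1]. The remaining [q * s]
   in the bound on [N] makes the second at most [expR (- q * (n * s))], where [n * s >= 1]. *)
pose a := n%:R * (e - (129 + q) * s).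
apply: le_trans (E_mu_KN_le n N a (ltW s0) (laplace_rate_le (ltW s0) hm)) _.
rewrite lee_fin (_ : 2 * expR (- q) = expR (- q) + expR (- q)); last by ring.
apply: lerD.
  rewrite -expRM_natl -expRD ler_expR /a.
  rewrite (_ : _ + _ = - q * (n%:R * s ^+ 2)); last by ring.
  by rewrite ns2 mulr1.
apply: le_trans (ler_wpM2l (expR_ge0 _) hN) _.
rewrite -expRD ler_expR /a -/s.
rewrite (_ : _ + _ = - q * (n%:R * s)); last by ring.
by rewrite -[leRHS]mulr1 !mulNr lerN2 ler_wpM2l.
Qed.

Lemma rho1_ge n (r delta : R) : 0 <= delta ->
  (forall N, (n < N)%N -> N%:R <= expR (r * n%:R) -> (E_mu_KN mu n N <= delta%:E)%E) ->
  (r%:E <= rho1 mu n delta)%E.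
Proof.
move=> d0 h; apply: ereal_sup_ubound; exists r => //=.
by apply: ge_ereal_sup => _ [N [nN Nr] <-]; exact: h.
Qed.

End LowerThreshold.

Unset Implicit Arguments.

Theorem theorem3p1 (R : realType) (mu : probability R R) :
  admissible mu -> even_measure mu ->
  forall delta : R, 0 < delta < 1 / 2 ->
  exists c : R, 0 < c /\
  exists n0 : nat, forall n : nat, (n0 <= n)%N ->
    ((1 - c / Num.sqrt n%:R)%:E * E_Lambda_star mu <= rho1 mu n delta)%E.
Proof.
move=> _ _ delta /andP[d0 d12].
have := E_Lambda_star_ge0 mu; have := E_Lambda_star_fin_num mu.
case Ee : (E_Lambda_star mu) => [e| |]// _; rewrite lee_fin le_eqVlt => /orP[/eqP <-|e0].
  (* If the expectation is 0, the exponent 0 suffices: it forces [N <= 1], which excludes [n < N]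
     for [n >= 1]. *)
  exists 1; split => //; exists 1%N => n n1; rewrite mule0.
  apply: rho1_ge; first exact: ltW.
  move=> N nN; rewrite mul0r expR0 -[1]/(1%:R) ler_nat => N1.
  by have := leq_trans nN N1; rewrite ltnS leqNgt n1.
(* Chosen so that [2 * expR (- q) = delta]. *)
pose q := ln (2 / delta).
have q0 : 0 <= q by rewrite ln_ge0// ler_pdivlMr//; lra.
(* Division by [e] turns the additive loss of the threshold into a relative one. *)
exists ((129 + 2 * q) / e); split; first by rewrite divr_gt0//; lra.
exists 1%N => n n1; rewrite -EFinM.
have -> : (1 - (129 + 2 * q) / e / Num.sqrt n%:R) * e
    = e - (129 + 2 * q) / Num.sqrt n%:R :> R.
  by rewrite mulrBl mul1r mulrAC divfK// gt_eqF.
apply: rho1_ge; first exact: ltW.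
move=> N _ hN; apply: le_trans (E_mu_KN_le_threshold n1 q0 Ee hN) _.
by rewrite lee_fin expRN lnK ?posrE ?divr_gt0// invf_div mulrC divfK.
Qed.
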